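(* Let $E\subset\mathbb{T}$ be a weak peak set for $W^+$ and let $h_E=f_b$, with $b\in\ell^1$, be a corresponding weak peak function. Let $\nu\in\mathcal{R}$ be a probability measure on $\mathbb{T}$ with $\operatorname{supp}\nu\subset E$. Then $b$ is a modulus support functional for $S_0$, and $y=(y_j)_{j\ge0}$, $y_j=\widehat\nu(-j)$, is a corresponding modulus support point of $S_0$.
   Context: All spaces are complex. $\mathbb{D}=\{z\in\mathbb{C}:|z|<1\}$, $\mathbb{T}=\{z\in\mathbb{C}:|z|=1\}$, $\overline{\mathbb{D}}=\mathbb{D}\cup\mathbb{T}$. Duality: $c_0=c_0(\mathbb{Z}_+)$ with the sup norm, and $c_0^*$ is identified with $\ell^1=\ell^1(\mathbb{Z}_+)$ via the bilinear coupling $\langle a,x\rangle=\sum_{n\ge0}x_na_n$, $x\in c_0$, $a\in\ell^1$. Wiener algebra: $W^+$ is the algebra of functions $f_a(z)=\sum_{n\ge0}a_nz^n$ with $a=(a_n)_{n\ge0}\in\ell^1$ (analytic in $\mathbb{D}$, continuous on $\overline{\mathbb{D}}$). $\|f\|_\infty=\sup_{z\in\overline{\mathbb{D}}}|f(z)|$. The set $S_0$: for $\lambda\in\mathbb{D}$ let $\varphi_\lambda=(\lambda^j)_{j\ge0}\in c_0$ (with $0^0=1$). $S_0$ is the closed convex hull in $c_0$ of $\{\varphi_\lambda:\lambda\in\mathbb{D}\}$. Modulus support functionals: for a non-empty bounded closed convex subset $C$ of a Banach space $X$, a non-zero functional $h\in X^*$ is a modulus support functional for $C$ if there is $y\in C$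 with $|h(y)|=\sup_{x\in C}|h(x)|$; such a point $y$ is called a modulus support point of $C$ corresponding to $h$. Class $\mathcal{R}$: for a finite complex Borel measure $\mu$ on $\mathbb{T}$, $\widehat\mu(k)=\int_{\mathbb{T}}t^{-k}\,\mu(dt)$, $k\in\mathbb{Z}$. The measure $\mu$ belongs to $\mathcal{R}$ (Rajchman class) if $\lim_{n\to+\infty}\widehat\mu(-n)=0$. Weak peak sets: a closed set $E\subset\mathbb{T}$ of Lebesgue measure zero is a weak peak set for $W^+$ if there are a function $g_E\in W^+$ (called a weak peak function for $E$) and a complex number $\beta\ne0$ such that $g_E=\beta$ on $E$ and $\|g_E\|_\infty=|\beta|$. *)

(* Defs.v *)
From HB Require Import structures.
From mathcomp Require Import all_boot all_order all_algebra complex.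
From mathcomp Require Import all_classical all_reals all_analysis.

Set Implicit Arguments.
Unset Strict Implicit.
Unset Printing Implicit Defensive.

Import Order.TTheory GRing.Theory Num.Theory.
Import numFieldNormedType.Exports.

Local Open Scope classical_set_scope.
Local Open Scope ring_scope.
Local Open Scope complex_scope.

(* The regular module R[i]^o, and not R[i] itself, is the one that carries a
   topology and a structure of normed space over the scalars R[i].  Its norm
   `|z| takes values in R[i]; Normc.normc z is the same modulus read in R. *)
Notation CC R := (GRing.regular R[i]).
Notation normc := Normc.normc.
Import Normc.

Lemma normc_ge0 (R : rcfType) (z : R[i]) : 0 <= normc z.
Proof. by case: z => a b; exact: sqrtr_ge0. Qed.

Lemma cvg0_submod_closed (K : numFieldType) (V : normedModType K) :
  submod_closed [pred x : nat -> V | `[< x @ \oo --> (0 : V) >]].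
Proof.
split; first by apply/asboolP; exact: cvg_cst.
move=> a u v /asboolP u0 /asboolP v0; apply/asboolP.
rewrite -[0 in X in _ --> X](addr0 0) -{1}(scaler0 _ a).
by apply: cvgD => //; apply: cvgZl_tmp.
Qed.

Definition c0_pred {R : realType} : {pred nat -> CC R} :=
  [pred x | `[< x @ \oo --> (0 : CC R) >]].

HB.instance Definition _ (R : realType) :=
  GRing.isSubmodClosed.Build _ _ (@c0_pred R) (cvg0_submod_closed _).

Record c0 (R : realType) :=
  MkC0 { c0_seq :> nat -> CC R; c0_seqP : c0_seq \in @c0_pred R }.

HB.instance Definition _ (R : realType) := [isSub for @c0_seq R].
HB.instance Definition _ (R : realType) := [Choice of c0 R by <:].
HB.instance Definition _ (R : realType) := [SubChoice_isSubLmodule of c0 R by <:].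

Section C0Norm.
Context {R : realType}.
Implicit Types (x y : c0 R) (n : nat).

(* The sup norm, as a (real) element of R[i] *)
Definition c0_norm x : R[i] := (sup (range (fun n => normc (x n))))%:C.

Lemma c0_cvg x : x @ \oo --> (0 : CC R).
Proof. exact/asboolP/(c0_seqP x). Qed.

Let has_ub x : has_ubound (range (fun n => normc (x n))).
Proof.
have /cvg_seq_bounded/pinfty_ex_gt0[M M_gt0 /= xM] : cvgn (x : nat -> CC R).
  by apply: cvgP; exact: c0_cvg.
exists (complex.Re M) => _ [n _ <-].
by have /= := xM n I; rewrite lecE => /andP[].
Qed.

Lemma normc_le_c0_norm x n : (normc (x n))%:C <= c0_norm x.
Proof. by rewrite lecR; apply: ub_le_sup => //; exists n. Qed.

Lemma c0_norm_le x (e : R) :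
  (forall n, normc (x n) <= e) -> c0_norm x <= e%:C.
Proof.
move=> xe; rewrite lecR; apply: ge_sup; first by exists (normc (x 0%N)), 0%N.
by move=> _ [n _ <-].
Qed.

Lemma c0_normD x y : c0_norm (x + y) <= c0_norm x + c0_norm y.
Proof.
rewrite -rmorphD; apply: c0_norm_le => n.
apply: (le_trans (le_normcD (x n) (y n))).
by apply: lerD; rewrite -lecR; exact: normc_le_c0_norm.
Qed.

Lemma c0_normZ (l : R[i]) x : c0_norm (l *: x) = `|l| * c0_norm x.
Proof.
have le (a : R[i]) z : c0_norm (a *: z) <= `|a| * c0_norm z.
  rewrite -[`|a|]/((normc a)%:C) -rmorphM; apply: c0_norm_le => n.
  rewrite (normcM a (z n)) ler_wpM2l ?normc_ge0//.
  by rewrite -lecR; exact: normc_le_c0_norm.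
apply/eqP; rewrite eq_le le /=.
have [->|l0] := eqVneq l 0.
  rewrite normr0 mul0r; apply: le_trans (normc_le_c0_norm _ 0%N).
  by rewrite lecR normc_ge0.
rewrite -ler_pdivlMl ?normr_gt0// -normfV.
by apply: le_trans (le _ _); rewrite scalerA mulVf// scale1r.
Qed.

Lemma c0_norm0_eq0 x : c0_norm x = 0 -> x = 0.
Proof.
move=> x0; apply/val_inj/funext => n /=; apply/eq0_normc/le_anti/andP; split.
  by rewrite -lecR; apply: le_trans (normc_le_c0_norm x n) _; rewrite x0.
exact: normc_ge0.
Qed.

HB.instance Definition _ :=
  Lmodule_isNormed.Build R[i] (c0 R) c0_normD c0_normZ c0_norm0_eq0.

End C0Norm.

Section Complete.
Context {R : realType}.

Let CC_Cauchy_part (F : set_system (CC R)) (p : CC R -> R) :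
    (forall z w, p (z - w) = p z - p w) -> (forall z, `|p z|%:C <= `|z|) ->
  ProperFilter F -> cauchy F -> exists a : R, p @ F --> a.
Proof.
move=> pB p_le FF /cauchyP Fc.
have pF : ProperFilter (p @ F) by exact: fmap_proper_filter.
apply/cvg_ex; apply: (R_complete pF).
apply/cauchyP => e e0; have e0' : 0 < e%:C by rewrite ltcR.
have [z Fz] := Fc _ e0'; exists (p z).
suff : ball z e%:C `<=` p @^-1` (ball (p z) e) by move/filterS; exact.
move=> w; rewrite /preimage/= -!ball_normE /= => zw.
by have := le_lt_trans (p_le (z - w)) zw; rewrite ltcR pB.
Qed.

Lemma CC_complete (F : set_system (CC R)) : ProperFilter F -> cauchy F -> cvg F.
Proof.
move=> FF Fc.
have [a Fa] : exists a : R, (@complex.Re R : CC R -> R) @ F --> a.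
  apply: CC_Cauchy_part => // [[? ?] [? ?]//|z]; exact: normc_ge_Re.
have [b Fb] : exists b : R, (@complex.Im R : CC R -> R) @ F --> b.
  apply: CC_Cauchy_part => // [[? ?] [? ?]//|[x y]].
  by rewrite lecR -sqrtr_sqr /= ler_wsqrtr// lerDr sqr_ge0.
apply/cvg_ex; exists (a +i* b); apply/cvgrPdist_lt => e e0.
have eE : e = (complex.Re e)%:C by rewrite RRe_real// gtr0_real.
have e20 : 0 < complex.Re e / 2 by rewrite divr_gt0// -ltcR -eE.
move/cvgrPdist_lt : Fa => /(_ _ e20) Fa; move/cvgrPdist_lt : Fb => /(_ _ e20) Fb.
apply: filterS2 Fa Fb => -[x y] /= xa yb.
have -> : (a +i* b - (x +i* y) : CC R) = ((a - x) +i* 0) + (0 +i* (b - y)).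
  by rewrite /GRing.add/= add0r addr0.
apply: (le_lt_trans (ler_normD _ _)).
rewrite eE [complex.Re e]splitr rmorphD ltrD// -[`|_|]/(normc _)%:C ltcR /=;
  by rewrite expr0n/= ?addr0 ?add0r sqrtr_sqr.
Qed.

HB.instance Definition _ := Uniform_isComplete.Build (CC R) CC_complete.

Lemma c0_complete (F : set_system (c0 R)) : ProperFilter F -> cauchy F -> cvg F.
Proof.
move=> FF Fc.
have coord_le (x y : c0 R) n : `|x n - y n| <= `|x - y|.
  exact: (normc_le_c0_norm (x - y) n).
have Fn n : exists l : CC R, (fun x : c0 R => x n) @ F --> l.
  have nF : ProperFilter ((fun x : c0 R => x n) @ F) by exact: fmap_proper_filter.
  apply/cvg_ex; apply: (CC_complete nF).
  apply/cauchyP => e e0; have [z Fz] := (cauchyP F).1 Fc _ e0; exists (z n).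
  suff : ball z e `<=` (fun x : c0 R => x n) @^-1` (ball (z n) e).
    by move/filterS; exact.
  move=> w; rewrite /preimage/= -!ball_normE /=.
  exact: le_lt_trans (coord_le _ _ _).
have [l Fl] := choice Fn.
have near_l (e : R[i]) : 0 < e -> exists z : c0 R, 
    F (ball z e) /\ forall n, `|z n - l n| <= e.
  move=> e0; have [z Fz] := (cauchyP F).1 Fc _ e0; exists z; split=> // n.
  apply/ler_addgt0Pr => d d0.
  move/cvgrPdist_lt : (Fl n) => /(_ _ d0) /(filterI Fz)/filter_ex[w [/=]].
  rewrite -ball_normE /= => zw lw.
  rewrite -(subrKA (w n)) (le_trans (ler_normD _ _))// lerD//.
    exact: le_trans (coord_le _ _ _) (ltW zw).
  by rewrite distrC ltW.
have l0 : l \in c0_pred.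
  apply/asboolP/cvgrPdist_lt => e e0.
  have e20 : 0 < e / 2 by rewrite divr_gt0.
  have [z [_ zl]] := near_l _ e20.
  move/cvgrPdist_lt : (c0_cvg z) => /(_ _ e20); apply: filterS => n.
  rewrite !sub0r !normrN => zn.
  rewrite -(subrK (z n) (l n)) (le_lt_trans (ler_normD _ _))//.
  by rewrite [e]splitr ler_ltD// distrC.
apply/cvg_ex; exists (MkC0 l0); apply/cvgrPdist_le => e e0.
have e20 : 0 < e / 2 by rewrite divr_gt0.
have [z [Fz zl]] := near_l _ e20.
apply: filterS Fz => w; rewrite -ball_normE /= => zw.
rewrite -(subrKA z) (le_trans (ler_normD _ _))// [e]splitr lerD ?(ltW zw)//.
have eE : e / 2 = (complex.Re (e / 2))%:C by rewrite RRe_real// gtr0_real.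
rewrite eE; apply: c0_norm_le => n; rewrite -lecR -eE.
by have := zl n; rewrite distrC.
Qed.

HB.instance Definition _ := Uniform_isComplete.Build (c0 R) c0_complete.

End Complete.

Definition closed_convex_hull (K : numFieldType) (X : normedModType K)
    (A : set X) : set X :=
  smallest [set B : set X | closed B /\ convex_set B] A.

Section ModulusSupport.
Context {R : realType} {X : completeNormedModType R[i]}.
Implicit Types (C : set X) (h : X -> CC R) (y : X).

Definition attains_modulus_sup h C y :=
  C y /\ normc (h y) = sup [set normc (h x) | x in C].

(* The standing assumptions on the convex set C and the requirement that h be a
   non-zero element of the dual of X are part of the predicate. *)
Definition modulus_support_functional h C :=
  [/\ [/\ C !=set0, bounded_set C, closed C & convex_set C],
      linear h, continuous h, (exists x, h x != 0) &
      exists y, attains_modulus_sup h C y].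

Definition modulus_support_point h C y :=
  modulus_support_functional h C /\ attains_modulus_sup h C y.

End ModulusSupport.

Section Sequences.
Context {R : realType}.
Implicit Types (a : nat -> CC R) (x : c0 R) (z : CC R).

Definition ell1 a := cvgn [normed series a].

(* The element of the dual of c0 that a in ell1 is identified with. *)
Definition coupling a x : CC R := limn [series x n * a n]_n.

Definition S0 : set (c0 R) :=
  closed_convex_hull
    [set x : c0 R | exists2 l : CC R, `|l| < 1 & forall j, x j = l ^+ j].

Definition power_series a z : CC R := limn [series a n * z ^+ n]_n.

(* Only the values of g on the closed unit disc matter, here and in
   [disc_sup_norm]; [power_series a] is unspecified where the series diverges. *)
Definition wiener (g : CC R -> CC R) :=
  exists2 a, ell1 a & forall z, `|z| <= 1 -> g z = power_series a z.

Definition disc_sup_norm (g : CC R -> CC R) : R :=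
  sup [set normc (g z) | z in [set z : CC R | `|z| <= 1]].

End Sequences.

Definition circle (R : realType) : Type := set_type [set z : CC R | `|z| = 1].

Definition circle_val (R : realType) (t : circle R) : CC R := set_val t.

HB.instance Definition _ (R : realType) := Choice.on (circle R).
HB.instance Definition _ (R : realType) := Topological.on (circle R).
HB.instance Definition _ (R : realType) := isPointed.Build (circle R)
  (exist _ (1 : CC R) (mem_set (normr1 _))).

Notation borel_circle R := (g_sigma_algebraType (@open (circle R))).

Section Circle.
Context {R : realType}.
Implicit Types (E : set (circle R)) (g : CC R -> CC R).

(* Lebesgue measure on the circle, transported from [0, 2 pi) *)
Definition arc_length E : \bar R :=
  lebesgue_measure [set s : R | 0 <= s < 2 * pi /\
    exists2 t, E t & circle_val t = cos s +i* sin s].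

Definition weak_peak_function E g :=
  wiener g /\ exists beta : CC R, [/\ beta != 0,
    (forall t, E t -> g (circle_val t) = beta) & disc_sup_norm g = normc beta].

Definition weak_peak_set E :=
  [/\ closed E, arc_length E = 0%E & exists g, weak_peak_function E g].

Implicit Types mu : {finite_measure set (borel_circle R) -> \bar R}.

Definition fourier_coef mu (k : int) : CC R :=
  let f (t : borel_circle R) : CC R := circle_val t ^ (- k) in
  Rintegral mu setT (fun t => complex.Re (f t)) +i*
  Rintegral mu setT (fun t => complex.Im (f t)).

(* The Rajchman condition, for positive finite measures *)
Definition rajchman mu :=
  fourier_coef mu (- n%:Z) @[n --> \oo] --> (0 : CC R).

Definition measure_support mu : set (circle R) :=
  [set t | forall U, open U -> U t -> (0 < mu U)%E].

End Circle.

(* Main.v *)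
Require Import Defs.
From HB Require Import structures.
From mathcomp Require Import all_boot all_order all_algebra complex.
From mathcomp Require Import all_classical all_reals all_analysis.
From mathcomp Require Import measurable_realfun ring lra.

Set Implicit Arguments.
Unset Strict Implicit.
Unset Printing Implicit Defensive.

Import Order.TTheory GRing.Theory Num.Theory.
Import numFieldNormedType.Exports.
Import Normc.

Local Open Scope classical_set_scope.
Local Open Scope ring_scope.

(** Write [f] for the power series with coefficients [b], and [beta] for its
    peak value, so that [f = beta] on [E] and [|f| <= |beta|] on the closed
    disc.  On a geometric sequence [(l ^+ j)_j] with [|l| < 1] the functional
    [coupling b] takes the value [f l].  Its modulus is therefore at most
    [|beta|] on the generators of [S0], hence on all of [S0], because
    [{x | |h x| <= |beta|}] is closed and convex for every continuous linear
    [h] ([S0_sub_le]).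

    Let [y] be the sequence of moments [y j = int t ^+ j d nu], which is in
    [c0] by the Rajchman condition.  The bound is attained at [y], since
    [coupling b y = int f d nu = beta]: [f] equals [beta] on [E], [nu] is
    concentrated on [E], and the partial sums of [f] converge uniformly on the
    circle, so that sum and integral may be exchanged
    ([coupling_fourier_coef]).  As [beta != 0], the functional is not zero.

    It remains to see that [y] is in [S0] ([fourier_coef_S0]).  For [r < 1]
    the sequence [(r ^+ j * y j)_j] is the barycenter of the generators with
    parameters [r * t], [t] on the circle.  It is a limit of Riemann sums for
    partitions of the circle into small Borel cells, and each Riemann sum is a
    finite convex combination of generators.  These sums converge in the sup
    norm, because [|z ^+ j - w ^+ j| <= |z - w| / (1 - r)] uniformly in [j]
    when [|z|, |w| <= r] ([normc_pow_dist]).  Finally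
    [(r ^+ j * y j)_j] tends to [y] in [c0] as [r] tends to 1, because [y]
    tends to 0.

    The same partitions, at the scales [1 / n.+1], also show that the
    complement of the support of [nu] is a null set: it is covered by
    countably many null cells ([negligible_measure_supportC]). *)

(** * The modulus of complex numbers *)

Section ComplexModulus.
Context {R : realType}.
Implicit Types (z w : CC R) (e : R).

Lemma normr_normc z : `|z| = (normc z)%:C%C.
Proof. by []. Qed.

Lemma normc_distC z w : normc (z - w) = normc (w - z).
Proof. by rewrite -opprB normcN. Qed.

Lemma normcX z n : normc (z ^+ n) = normc z ^+ n.
Proof. by elim: n => [|n IH]; rewrite ?expr0 ?normc1// !exprS normcM IH. Qed.

Lemma normc_real (x : R) : normc x%:C%C = `|x|.
Proof. by rewrite /= expr0n /= addr0 sqrtr_sqr. Qed.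

Lemma normc_sum (I : Type) (s : seq I) (F : I -> CC R) :
  normc (\sum_(i <- s) F i) <= \sum_(i <- s) normc (F i).
Proof.
elim/big_ind2: _ => [|x1 x2 y1 y2 h1 h2|//]; first by rewrite normc0.
exact: le_trans (le_normcD _ _) (lerD h1 h2).
Qed.

Lemma normr_Re_le (z : CC R) : `|complex.Re z| <= normc z.
Proof. by rewrite -lecR; exact: normc_ge_Re. Qed.

Lemma normr_Im_le (z : CC R) : `|complex.Im z| <= normc z.
Proof. by case: z => x y; rewrite -sqrtr_sqr ler_wsqrtr// lerDr sqr_ge0. Qed.

Lemma normc_le_ReIm (z : CC R) : normc z <= `|complex.Re z| + `|complex.Im z|.
Proof.
case: z => x y /=; rewrite -[leRHS]ger0_norm ?addr_ge0// -sqrtr_sqr ler_wsqrtr//.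
by rewrite sqrrD !real_normK ?num_real// addrAC lerDl mulrn_wge0// mulr_ge0.
Qed.

Lemma ReM (z w : CC R) : complex.Re (z * w) =
  complex.Re z * complex.Re w - complex.Im z * complex.Im w.
Proof. by case: z w => [a b] [c e]. Qed.

Lemma ImM (z w : CC R) : complex.Im (z * w) =
  complex.Re z * complex.Im w + complex.Im z * complex.Re w.
Proof. by case: z w => [a b] [c e]. Qed.

Lemma ge0_complexE (e : R[i]) : 0 <= e -> e = (complex.Re e)%:C%C.
Proof. by move=> e0; rewrite RRe_real// ger0_real. Qed.

(** Reduces convergence in the complex plane to real estimates, so that the
    partial order of [R[i]] no longer appears in limit arguments. *)
Lemma cvgn_normcP (u : nat -> CC R) l : (u @ \oo --> l) <->
  forall e, 0 < e -> exists N, forall n, (N <= n)%N -> normc (l - u n) < e.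
Proof.
split=> [/cvgrPdist_lt ul e e0|ul].
  have e0' : 0 < e%:C%C by rewrite ltcR.
  have [N _ uN] := ul _ e0'; exists N => n Nn.
  by rewrite -ltcR; exact: uN.
apply/cvgrPdist_lt => e e0; rewrite (ge0_complexE (ltW e0)).
have [|N uN] := ul (complex.Re e); first by rewrite -ltcR -ge0_complexE// ltW.
by exists N => // n /= Nn; rewrite normr_normc ltcR uN.
Qed.

Lemma normc_lim_le (u : nat -> CC R) l c e N : u @ \oo --> l ->
  (forall n, (N <= n)%N -> normc (u n - c) <= e) -> normc (l - c) <= e.
Proof.
move=> /cvgn_normcP ul ue; apply/ler_addgt0Pr => d d0.
have [M uM] := ul _ d0; pose n := maxn N M.
rewrite -(subrKA (u n)) addrC; apply: le_trans (le_normcD _ _) _.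
by rewrite lerD ?ue ?leq_maxl// ltW// uM// leq_maxr.
Qed.

(** The factor [1 / (1 - r)] does not depend on [n]: this is what makes
    [l |-> (l ^+ j)_j] Lipschitz from the disc of radius [r] to [c0].
    Induction on [n] works because [r * (d / (1 - r)) + d = d / (1 - r)]. *)
Lemma normc_pow_dist r z w n : 0 <= r < 1 -> normc z <= r -> normc w <= r ->
  normc (z ^+ n - w ^+ n) <= normc (z - w) / (1 - r).
Proof.
move=> /andP[r0 r1] zr wr; have r10 : 0 < 1 - r by rewrite subr_gt0.
elim: n => [|n IH]; first by rewrite !expr0 subrr normc0 divr_ge0 ?normc_ge0 ?ltW.
have -> : z ^+ n.+1 - w ^+ n.+1 = z * (z ^+ n - w ^+ n) + (z - w) * w ^+ n.
  by rewrite !exprS mulrBr mulrBl addrA subrK.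
apply: le_trans (le_normcD _ _) _; rewrite !normcM.
have -> : normc (z - w) / (1 - r) = r * (normc (z - w) / (1 - r)) + normc (z - w).
  by field; rewrite gt_eqF.
rewrite lerD//; first by rewrite ler_pM ?normc_ge0.
by rewrite ler_piMr ?normc_ge0// normcX exprn_ile1 ?normc_ge0// (le_trans wr)// ltW.
Qed.

End ComplexModulus.

(** * Closed convex sets *)

Section ClosedConvex.
Context {K : numFieldType} {V : normedModType K}.
Implicit Types (A C : set V).

(** Closedness through approximation: distances in [K] are only partially
    ordered, as for [K = R[i]], and this form uses no comparison but with a
    given [e]. *)
Lemma closed_normP C : closed C <->
  forall x, (forall e : K, 0 < e -> exists2 y, C y & `|x - y| < e) -> C x.
Proof.
split=> [Cc x xC|CP].
  apply: Cc => B /nbhs_ballP[e /= e0]; rewrite -ball_normE => eB.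
  by have [y Cy xy] := xC _ e0; exists y; split=> //; exact: eB.
move=> x xC; apply: CP => e e0.
by have [y [Cy]] := xC _ (nbhsx_ballx x e e0); rewrite -ball_normE; exists y.
Qed.

Lemma closed_normr_le (B : K) : closed [set x : V | `|x| <= B].
Proof.
apply/closed_normP => x xB /=; apply/ler_addgt0Pr => e e0.
have [y /= yB xy] := xB _ e0.
by rewrite -(subrK y x) addrC (le_trans (ler_normD _ _))// lerD// ltW.
Qed.

Lemma convex_linear_le {W : normedModType K} (h : V -> W) (B : K) : linear h ->
  convex_set [set x : V | `|h x| <= B].
Proof.
move=> lh x y k /set_mem /= xB /set_mem /= yB; apply/mem_set => /=.
have hZ a v : h (a *: v) = a *: h v.
  have h0 : h 0 = 0 by have := lh (- 1) 0 0; rewrite scaler0 addr0 scaleN1r addNr.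
  by have := lh a v 0; rewrite addr0 h0 addr0.
have k1 : 0 <= 1 - k%:num :> K by rewrite subr_ge0.
rewrite /conv /= lh hZ; apply: le_trans (ler_normD _ _) _.
rewrite !normrZ (ger0_norm k1) ger0_norm//.
have -> : B = k%:num * B + (1 - k%:num) * B by rewrite -mulrDl addrC subrK mul1r.
by rewrite lerD// ler_wpM2l.
Qed.

(** Finite convex combinations, with weights that are not normalized: in this
    form the induction on [s] also covers the case where the weights met so far
    sum to zero, when any point of [C] will do. *)
Lemma convex_set_sum C (I : Type) (s : seq I) (w : I -> K) (x : I -> V) :
  convex_set C -> C !=set0 -> (forall i, 0 <= w i) -> (forall i, C (x i)) ->
  exists2 c, C c & \sum_(i <- s) w i *: x i = (\sum_(i <- s) w i) *: c.
Proof.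
move=> Cc [c0 Cc0] w0 Cx; elim: s => [|i s [c Ccc IH]].
  by exists c0 => //; rewrite !big_nil scale0r.
rewrite !big_cons IH; set W := \sum_(_ <- _) _.
have W0 : 0 <= W by rewrite sumr_ge0.
have [/eqP|wW] := eqVneq (w i + W) 0.
  rewrite paddr_eq0// => /andP[/eqP -> /eqP ->].
  by exists c => //; rewrite addr0 !scale0r addr0.
have k01 : Itv.spec (@Itv.num_sem K) (Itv.Real `[0%Z, 1%Z]) (w i / (w i + W)).
  have wW0 : 0 < w i + W by rewrite lt_neqAle eq_sym wW addr_ge0.
  have q0 : 0 <= w i / (w i + W) by rewrite divr_ge0 ?(ltW wW0).
  rewrite /= /Itv.num_sem /= in_itv /=; apply/and3P; split; rewrite ?ger0_real//.
  by rewrite ler_pdivrMr// mul1r lerDl.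
exists (conv (Itv.mk k01 : {i01 K}) (x i : convex_lmodType V) c).
  by apply: set_mem; apply: Cc; exact: mem_set.
rewrite /conv /= scalerDr !scalerA; congr (_ *: _ + _ *: _).
  by rewrite mulrC divfK.
by rewrite /unstable.onem mulrBr mulr1 mulrC divfK// addrAC subrr add0r.
Qed.

Lemma closed_convex_hull_closed A : closed (closed_convex_hull A).
Proof.
apply/closed_normP => x xA B AB; apply: ((closed_normP _).1 AB.1.1) => e e0.
by have [y yA xy] := xA _ e0; exists y => //; exact: (yA B AB).
Qed.

Lemma closed_convex_hull_convex A : convex_set (closed_convex_hull A).
Proof.
move=> x y k /set_mem xA /set_mem yA; apply/mem_set => B AB.
by apply: set_mem; apply: (AB.1.2); apply: mem_set; [exact: (xA B AB)|exact: (yA B AB)].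
Qed.

End ClosedConvex.

(** * Absolutely summable series and the coupling of c0 with ell1 *)

Section AbsolutelySummable.
Context {R : realType}.
Implicit Types (b u : nat -> CC R) (e : R).

Lemma ell1_tail b e : ell1 b -> 0 < e ->
  exists N, forall n m, (N <= n)%N -> \sum_(n <= k < m) normc (b k) < e.
Proof.
move=> bc e0; have e20 : 0 < e / 2 by rewrite divr_gt0.
have /cvg_ex[/= l bl] : cvgn ([normed series b] : nat -> CC R) by exact: bc.
have [N bN] := (cvgn_normcP _ l).1 bl _ e20.
exists N => n m Nn; have [mn|/ltnW nm] := leqP m n; first by rewrite big_geq.
have -> : \sum_(n <= k < m) normc (b k) =
    normc ([normed series b] m - [normed series b] n).
  rewrite /normed_series_of (sub_series_geq _ nm).
  rewrite (eq_bigr (fun k => (normc (b k))%:C%C))//.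
  rewrite -rmorph_sum normc_real ger0_norm// sumr_ge0// => k _.
  exact: normc_ge0.
rewrite -(subrKA l) (le_lt_trans (le_normcD _ _))// [e]splitr ltrD//; last first.
  exact: bN.
by rewrite normc_distC bN// (leq_trans Nn).
Qed.

(** The rank [N] is chosen before the dominated sequence [u]; this uniformity
    serves both for the continuity of the coupling and for the uniform
    convergence of power series on the closed disc. *)
Lemma dominated_series b e : ell1 b -> 0 < e ->
  exists N, forall u (M : R), 0 <= M -> (forall k, normc (u k) <= M * normc (b k)) ->
    cvgn (series u) /\
    forall n, (N <= n)%N -> normc (limn (series u) - series u n) <= M * e.
Proof.
move=> be e0; have [N bN] := ell1_tail be e0; exists N => u M M0 uM.
have u_le n m : (n <= m)%N ->
    normc (series u m - series u n) <= M * \sum_(n <= k < m) normc (b k).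
  move=> nm; rewrite (sub_series_geq _ nm).
  rewrite mulr_sumr; apply: le_trans (normc_sum _ _) _.
  exact: ler_sum.
have uc : cvgn (series u).
  apply: CC_complete; apply/cauchy_seriesP => d d0.
  set d' := complex.Re d.
  have d'0 : 0 < d' by rewrite -ltcR -ge0_complexE// ltW.
  have M10 : 0 < M + 1 by rewrite ltr_pwDr.
  have [N' bN'] := ell1_tail be (divr_gt0 d'0 M10).
  have u_lt n m : (N' <= n)%N -> (n <= m)%N ->
      normc (series u m - series u n) < d'.
    move=> Nn nm; apply: le_lt_trans (u_le _ _ nm) _.
    have := bN' n m Nn; rewrite ltr_pdivlMr// mulrDr mulr1 mulrC.
    apply: le_lt_trans; rewrite lerDl sumr_ge0// => k _; exact: normc_ge0.
  exists ([set n | (N' <= n)%N], [set n | (N' <= n)%N]); first by split; exists N'.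
  move=> [n m] [/= Nn Nm]; have [nm|/ltnW mn] := leqP n m; last first.
    by rewrite big_geq// normr0 (ge0_complexE (ltW d0)) ltcR.
  rewrite -(sub_series_geq u nm) (ge0_complexE (ltW d0)) normr_normc ltcR.
  exact: u_lt.
split=> // n Nn; apply: (normc_lim_le (N := n) uc) => m nm.
apply: le_trans (u_le _ _ nm) _; rewrite ler_wpM2l// ltW//; exact: bN.
Qed.

End AbsolutelySummable.

Section Coupling.
Context {R : realType}.
Variable b : nat -> CC R.
Hypothesis b_ell1 : ell1 b.
Implicit Types (x y : c0 R) (z : CC R).

(** The sup norm as a real number; the norm of [c0 R] has values in [R[i]]. *)
Definition c0_normR x : R := sup (range (fun n => normc (x n))).

Lemma c0_normE x : `|x| = (c0_normR x)%:C%C.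
Proof. by []. Qed.

Lemma normc_le_c0_normR x n : normc (x n) <= c0_normR x.
Proof. by rewrite -lecR; exact: normc_le_c0_norm. Qed.

Lemma c0_normR_ge0 x : 0 <= c0_normR x.
Proof. exact: le_trans (normc_ge0 _) (normc_le_c0_normR x 0%N). Qed.

Let dominated x k : normc (x k * b k) <= c0_normR x * normc (b k).
Proof. by rewrite normcM ler_wpM2r ?normc_ge0// normc_le_c0_normR. Qed.

Lemma is_cvg_coupling x : cvgn [series x n * b n]_n.
Proof.
have [N /(_ _ _ (c0_normR_ge0 x) (dominated x))[]//] := dominated_series b_ell1 ltr01.
Qed.

Lemma coupling_linear : linear (coupling b).
Proof.
move=> a x y; rewrite /coupling.
have -> : [series (a *: x + y) n * b n]_n =
    a *: [series x n * b n]_n + [series y n * b n]_n :> (nat -> CC R).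
  rewrite -seriesZ -seriesD; congr series; apply/funext => n.
  rewrite -[LHS]/((a * x n + y n) * b n).
  rewrite -[RHS]/(a * (x n * b n) + y n * b n).
  by rewrite mulrDl -mulrA.
apply: (cvg_lim (@norm_hausdorff _ _)); apply: cvgD; last exact: is_cvg_coupling.
by apply: cvgZl_tmp; exact: is_cvg_coupling.
Qed.

Lemma coupling_continuous : continuous (coupling b).
Proof.
have [N bN] := dominated_series b_ell1 ltr01.
pose B := \sum_(k < N) normc (b k) + 1.
have hB x : `|coupling b x| <= B%:C%C * `|x|.
  rewrite normr_normc c0_normE -rmorphM lecR mulrDl mul1r.
  have [_ /(_ _ (leqnn N))] := bN _ _ (c0_normR_ge0 x) (dominated x).
  rewrite mulr1 -/(coupling b x) => hN.
  rewrite -[coupling b x](subrK ([series x n * b n]_n N)) addrC.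
  apply: le_trans (le_normcD _ _) _; rewrite lerD//.
  rewrite /series /= big_mkord mulr_suml; apply: le_trans (normc_sum _ _) _.
  by apply: ler_sum => k _; rewrite [leRHS]mulrC; exact: dominated.
pose h : {linear c0 R -> CC R} := HB.pack (coupling b)
  (GRing.isLinear.Build _ _ _ _ (coupling b) coupling_linear).
apply: (@bounded_linear_continuous _ _ _ h).
apply/linear_boundedP; near=> r => x.
apply: le_trans (hB x) _; rewrite ler_wpM2r//; near: r.
by apply: nbhs_pinfty_ge; rewrite complex_real.
Unshelve. all: by end_near. Qed.

End Coupling.

(** * The set S0 *)

Section S0.
Context {R : realType}.
Implicit Types (x y : c0 R) (l : CC R) (e : R).

Lemma geometric_c0_pred l : normc l < 1 -> (fun j => l ^+ j : CC R) \in @c0_pred R.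
Proof.
move=> l1; apply/asboolP/cvgn_normcP => e e0.
have : `|normc l| < 1 by rewrite ger0_norm ?normc_ge0.
move=> /(cvg_geometric 1)/cvgrPdist_lt/(_ _ e0)[N _ lN].
exists N => n /lN /=; rewrite !sub0r normrN mul1r normcN normcX.
by rewrite ger0_norm// exprn_ge0// normc_ge0.
Qed.

Lemma geometric_S0 l : normc l < 1 ->
  exists2 x, S0 x & forall j, x j = l ^+ j.
Proof.
move=> l1; exists (MkC0 (geometric_c0_pred l1)); last by [].
apply: sub_gen_smallest => /=; exists l; last by [].
by move: l1; rewrite -ltcR; exact.
Qed.

(** A bound on the modulus of a functional passes from the generators to the
    closed convex hull, since it defines a closed convex set. *)
Lemma S0_sub_le (W : normedModType R[i]) (h : c0 R -> W) (B : R[i]) :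
  linear h -> continuous h ->
  (forall x l, normc l < 1 -> (forall j, x j = l ^+ j) -> `|h x| <= B) ->
  @S0 R `<=` [set x | `|h x| <= B].
Proof.
move=> lh ch hB; apply: smallest_sub.
  split; last exact: convex_linear_le.
  exact: ((continuous_closedP h).1 ch _ (@closed_normr_le _ W B)).
by move=> x [l l1 xl]; apply: (hB _ l _ xl); rewrite -ltcR.
Qed.

Lemma S0_neq0 : @S0 R !=set0.
Proof.
by have [|x xS _] := @geometric_S0 0; [rewrite normc0 ltr01|exists x].
Qed.

Lemma S0_bounded : bounded_set (@S0 R).
Proof.
exists 1; split=> // M M1 x xS; apply: le_trans (ltW M1).
have id_cont : continuous (@id (c0 R)) by move=> z; exact: cvg_id.
apply: (S0_sub_le _ id_cont) x xS => // {M M1}x l l1 xl.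
rewrite -[1]/(1%:C%C); apply: c0_norm_le => n; rewrite xl normcX.
by rewrite exprn_ile1 ?normc_ge0// ltW.
Qed.

Lemma S0_approx y : (forall e, 0 < e ->
  exists2 x, S0 x & forall j, normc (y j - x j) <= e) -> S0 y.
Proof.
move=> yS; have /closed_normP := @closed_convex_hull_closed _ _
  [set x : c0 R | exists2 l : CC R, `|l| < 1 & forall j, x j = l ^+ j].
apply=> e e0; have e20 : 0 < complex.Re e / 2.
  by rewrite divr_gt0// -ltcR -ge0_complexE// ltW.
have [x xS yx] := yS _ e20; exists x => //.
have /le_lt_trans -> // : `|y - x| <= (complex.Re e / 2)%:C%C by exact: c0_norm_le.
rewrite [ltRHS]ge0_complexE ?ltW// ltcR; move: e20; lra.
Qed.

Lemma S0_barycenter (I : finType) (w : I -> R) (l : I -> CC R) :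
  (forall i, 0 <= w i) -> \sum_i w i = 1 -> (forall i, normc (l i) < 1) ->
  exists2 x, S0 x & forall j, x j = \sum_i (w i)%:C%C * l i ^+ j.
Proof.
move=> w0 w1 l1.
have /choice[phi phiP] : forall i, exists x : c0 R,
    S0 x /\ forall j, x j = l i ^+ j.
  by move=> i; have [x] := geometric_S0 (l1 i); exists x.
have phiS i := (phiP i).1; have phiE i := (phiP i).2.
have w0C i : 0 <= (w i)%:C%C by rewrite lecR.
have [x xS] := convex_set_sum (index_enum I)
  (@closed_convex_hull_convex _ _ _) S0_neq0 w0C phiS.
rewrite -rmorph_sum w1 scale1r => xE; exists x => // j; rewrite -xE {xE}.
elim: (index_enum I) => [|i s IH]; first by rewrite !big_nil.
rewrite !big_cons -IH -phiE.
by [].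
Qed.

End S0.

(** * Integrals of bounded complex functions *)

Section ComplexIntegral.
Context {R : realType} d {T : measurableType d} (mu : probability T R).
Implicit Types (f g : T -> CC R) (M : R).

Definition cintegral f : CC R :=
  (Rintegral mu setT (fun t => complex.Re (f t)) +i*
   Rintegral mu setT (fun t => complex.Im (f t)))%C.

(** Unlike integrability, this condition is stable under products, hence holds
    for all polynomials in the coordinate on the circle. *)
Definition bounded_measurable f :=
  [/\ measurable_fun setT (fun t => complex.Re (f t)),
      measurable_fun setT (fun t => complex.Im (f t)) &
      exists M, forall t, normc (f t) <= M].

Lemma bounded_measurable_cst (c : CC R) : bounded_measurable (fun=> c).
Proof. by split; [exact: measurable_cst..|exists (normc c)]. Qed.

Lemma bounded_measurableD f g : bounded_measurable f -> bounded_measurable g ->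
  bounded_measurable (fun t => f t + g t).
Proof.
move=> [f1 f2 [M fM]] [g1 g2 [N gN]]; split.
- rewrite (_ : (fun _ => _) = (fun t => complex.Re (f t)) \+ (fun t => complex.Re (g t))).
    exact: measurable_funD.
  by apply/funext => t /=; rewrite raddfD.
- rewrite (_ : (fun _ => _) = (fun t => complex.Im (f t)) \+ (fun t => complex.Im (g t))).
    exact: measurable_funD.
  by apply/funext => t /=; rewrite raddfD.
- by exists (M + N) => t; rewrite (le_trans (le_normcD _ _))// lerD.
Qed.

Lemma bounded_measurableM f g : bounded_measurable f -> bounded_measurable g ->
  bounded_measurable (fun t => f t * g t).
Proof.
move=> [f1 f2 [M fM]] [g1 g2 [N gN]]; split.
- rewrite (_ : (fun _ => _) =
    (fun t => complex.Re (f t)) \* (fun t => complex.Re (g t)) \-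
    (fun t => complex.Im (f t)) \* (fun t => complex.Im (g t))).
    by apply: measurable_funB; exact: measurable_funM.
  by apply/funext => t /=; rewrite ReM.
- rewrite (_ : (fun _ => _) =
    (fun t => complex.Re (f t)) \* (fun t => complex.Im (g t)) \+
    (fun t => complex.Im (f t)) \* (fun t => complex.Re (g t))).
    by apply: measurable_funD; exact: measurable_funM.
  by apply/funext => t /=; rewrite ImM.
- by exists (M * N) => t; rewrite normcM ler_pM// normc_ge0.
Qed.

Lemma bounded_measurableX f n : bounded_measurable f ->
  bounded_measurable (fun t => f t ^+ n).
Proof.
move=> fb; elim: n => [|n IH]; first exact: bounded_measurable_cst.
under eq_fun do rewrite exprS; exact: bounded_measurableM.
Qed.

Lemma bounded_measurable_sum (I : Type) (s : seq I) (F : I -> T -> CC R) :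
  (forall i, bounded_measurable (F i)) ->
  bounded_measurable (fun t => \sum_(i <- s) F i t).
Proof.
move=> Fb; elim: s => [|i s IH].
  under eq_fun do rewrite big_nil; exact: bounded_measurable_cst.
under eq_fun do rewrite big_cons; exact: bounded_measurableD.
Qed.

Lemma bounded_measurable_indic (A : set T) : measurable A ->
  bounded_measurable (fun t => (\1_A t)%:C%C).
Proof.
move=> mA; split; [exact: measurable_indic|exact: measurable_cst|].
exists 1 => t; rewrite normc_real indicE.
by case: (_ \in _); rewrite ?normr1// normr0 ler01.
Qed.

Let fin_mu : (mu setT < +oo)%E.
Proof. by rewrite probability_setT ltry. Qed.

Let integrable_part f (p : CC R -> R) : (forall z, `|p z| <= normc z) ->
  measurable_fun setT (fun t => p (f t)) -> (exists M, forall t, normc (f t) <= M) ->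
  mu.-integrable setT (EFin \o (fun t => p (f t))).
Proof.
move=> pn mp [M fM]; apply: measurable_bounded_integrable => //.
exists M; split=> [|x Mx t _ /=]; first exact: num_real.
by rewrite (le_trans (pn _))// (le_trans (fM t))// ltW.
Qed.

Lemma integrable_Re f : bounded_measurable f ->
  mu.-integrable setT (EFin \o (fun t => complex.Re (f t))).
Proof. move=> [? _ ?]; exact: (integrable_part normr_Re_le). Qed.

Lemma integrable_Im f : bounded_measurable f ->
  mu.-integrable setT (EFin \o (fun t => complex.Im (f t))).
Proof. move=> [_ ? ?]; exact: (integrable_part normr_Im_le). Qed.

Lemma cintegralD f g : bounded_measurable f -> bounded_measurable g ->
  cintegral (fun t => f t + g t) = cintegral f + cintegral g.
Proof.
move=> fb gb; rewrite /cintegral.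
have -> : (fun t => complex.Re (f t + g t)) =
  (fun t => complex.Re (f t) + complex.Re (g t)) by apply/funext => t; rewrite raddfD.
have -> : (fun t => complex.Im (f t + g t)) =
  (fun t => complex.Im (f t) + complex.Im (g t)) by apply/funext => t; rewrite raddfD.
by rewrite !RintegralD//; [exact: integrable_Im..|exact: integrable_Re|exact: integrable_Re].
Qed.

Lemma cintegralZ f (c : CC R) : bounded_measurable f ->
  cintegral (fun t => c * f t) = c * cintegral f.
Proof.
move=> fb; case: c => a b.
have Ref := integrable_Re fb; have Imf := integrable_Im fb.
have ZRe k : mu.-integrable setT (EFin \o (fun t => k * complex.Re (f t))).
  exact: (integrableZl measurableT k Ref).
have ZIm k : mu.-integrable setT (EFin \o (fun t => k * complex.Im (f t))).
  exact: (integrableZl measurableT k Imf).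
rewrite /cintegral.
under eq_Rintegral do rewrite ReM /=.
under [X in (_ +i* X)%C]eq_Rintegral do rewrite ImM /=.
by rewrite RintegralB// RintegralD// !RintegralZl.
Qed.

Lemma bounded_measurableB f g : bounded_measurable f -> bounded_measurable g ->
  bounded_measurable (fun t => f t - g t).
Proof.
move=> fb gb; under eq_fun do rewrite -[- g _]mulN1r.
apply: bounded_measurableD => //; apply: bounded_measurableM => //.
exact: bounded_measurable_cst.
Qed.

Lemma cintegralB f g : bounded_measurable f -> bounded_measurable g ->
  cintegral (fun t => f t - g t) = cintegral f - cintegral g.
Proof.
move=> fb gb; apply/eqP; rewrite eq_sym subr_eq -cintegralD//.
  by apply/eqP; congr cintegral; apply/funext => t; rewrite subrK.
exact: bounded_measurableB.
Qed.

Lemma cintegral_sum (I : Type) (s : seq I) (F : I -> T -> CC R) :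
  (forall i, bounded_measurable (F i)) ->
  cintegral (fun t => \sum_(i <- s) F i t) = \sum_(i <- s) cintegral (F i).
Proof.
move=> Fb; elim: s => [|i s IH].
  rewrite big_nil /cintegral.
  under eq_Rintegral do rewrite big_nil /=.
  under [X in (_ +i* X)%C]eq_Rintegral do rewrite big_nil /=.
  by rewrite !Rintegral_cst// !mul0r.
rewrite big_cons -IH -cintegralD//; last exact: bounded_measurable_sum.
by congr cintegral; apply/funext => t; rewrite big_cons.
Qed.

Lemma cintegral_cst (c : CC R) : cintegral (fun=> c) = c.
Proof.
case: c => a b; rewrite /cintegral /= !Rintegral_cst// [X in fine X]probability_setT /=.
by rewrite !mulr1.
Qed.

Lemma cintegral_indic (A : set T) : measurable A ->
  cintegral (fun t => (\1_A t)%:C%C) = (fine (mu A))%:C%C.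
Proof.
move=> mA; rewrite /cintegral /= Rintegral_cst// mul0r.
by rewrite /Rintegral integral_indic// setIT.
Qed.

Lemma step_indicE (I : finType) (idx : T -> I) (v : I -> CC R) :
  (fun t => v (idx t)) =
  (fun t => \sum_i v i * (\1_[set t | idx t = i] t)%:C%C).
Proof.
apply/funext => t; rewrite (bigD1 (idx t))//= indicE mem_set// rmorph1 mulr1.
rewrite big1 ?addr0// => i it; rewrite indicE memNset ?rmorph0 ?mulr0//=.
by move=> ti; rewrite ti eqxx in it.
Qed.

Section StepFunction.
Variables (I : finType) (idx : T -> I).
Hypothesis midx : forall i, measurable [set t | idx t = i].

Let bounded_measurable_term (v : I -> CC R) i :
  bounded_measurable (fun t => v i * (\1_[set t | idx t = i] t)%:C%C).
Proof.
apply: bounded_measurableM; first exact: bounded_measurable_cst.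
exact: bounded_measurable_indic.
Qed.

Lemma bounded_measurable_step (v : I -> CC R) :
  bounded_measurable (fun t => v (idx t)).
Proof. by rewrite step_indicE; exact: bounded_measurable_sum. Qed.

(** The integrals of step functions are the Riemann sums that approximate the
    barycenter in [fourier_coef_S0]. *)
Lemma cintegral_step (v : I -> CC R) :
  cintegral (fun t => v (idx t)) =
  \sum_i (fine (mu [set t | idx t = i]))%:C%C * v i.
Proof.
rewrite step_indicE cintegral_sum//; apply: eq_bigr => i _.
rewrite cintegralZ; last exact: bounded_measurable_indic.
by rewrite cintegral_indic// mulrC.
Qed.

End StepFunction.

(** The bound is asked on a set of full measure, rather than everywhere,
    because the value of a weak peak function is known on [E] alone. *)
Lemma normr_Rintegral_le (E : set T) (p : T -> R) M : measurable E ->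
  mu (~` E) = 0%E -> mu.-integrable setT (EFin \o p) -> 0 <= M ->
  (forall t, E t -> `|p t| <= M) -> `|Rintegral mu setT p| <= M.
Proof.
move=> mE E0 pI M0 pM.
have -> : Rintegral mu setT p = Rintegral mu E p.
  rewrite /Rintegral (negligible_integral (measurableC mE) measurableT pI)//.
  by rewrite setTD setCK.
have pIE : mu.-integrable E (EFin \o p) by exact: integrableS pI.
apply: le_trans (le_normr_Rintegral mE pIE) _.
apply: (@le_trans _ _ (Rintegral mu E (fun=> M))).
  apply: le_Rintegral => //; first exact: integrable_norm.
  apply: measurable_bounded_integrable => //.
    by rewrite (le_lt_trans (probability_le1 _ mE))// ltry.
  exists M; split=> [|x Mx t _ /=]; first exact: num_real.
  by rewrite ger0_norm// ltW.
rewrite Rintegral_cst// ler_piMr// -lee_fin fineK ?fin_num_measure//.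
exact: probability_le1.
Qed.

(** Bounding the real and the imaginary parts separately costs a factor 2,
    which does not matter in the limit arguments below. *)
Lemma normc_cintegral_le (E : set T) f M : measurable E -> mu (~` E) = 0%E ->
  bounded_measurable f -> 0 <= M -> (forall t, E t -> normc (f t) <= M) ->
  normc (cintegral f) <= M *+ 2.
Proof.
move=> mE E0 fb M0 fM; apply: le_trans (normc_le_ReIm _) _.
rewrite mulr2n lerD//= (normr_Rintegral_le mE E0)//.
- exact: integrable_Re.
- by move=> t Et; rewrite (le_trans (normr_Re_le _))// fM.
- exact: integrable_Im.
- by move=> t Et; rewrite (le_trans (normr_Im_le _))// fM.
Qed.

End ComplexIntegral.

(** * Probability measures on the circle *)

Section CircleMeasure.
Context {R : realType}.
Implicit Types (s t : borel_circle R) (E U : set (borel_circle R)).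

Lemma normc_circle t : normc (circle_val t) = 1.
Proof.
have /= := set_valP t; rewrite -/(circle_val t).
by rewrite normr_normc => -[].
Qed.

Lemma borel_open U : open (U : set (circle R)) -> measurable U.
Proof. exact: sub_sigma_algebra. Qed.

Lemma borel_closed U : closed (U : set (circle R)) -> measurable U.
Proof.
move=> cU; rewrite -(setCK U); apply: measurableC; apply: borel_open.
exact: closed_openC.
Qed.

(** The circle carries the initial topology for its inclusion in the plane, so
    that open sets contain traces of discs. *)
Lemma open_circleE U : open (U : set (circle R)) ->
  forall t, U t -> exists2 e : R, 0 < e &
    forall s, normc (circle_val t - circle_val s) < e -> U s.
Proof.
case=> A oA <- t At.
have /nbhs_ballP[e /= e0] : nbhs (circle_val t) A by exact: open_nbhs_nbhs.
rewrite -ball_normE => eA; exists (complex.Re e).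
  by rewrite -ltcR -ge0_complexE// ltW.
by move=> s ts; apply: eA; rewrite /= normr_normc (ge0_complexE (ltW e0)) ltcR.
Qed.

Lemma measurable_circle_part (p : CC R -> R) :
  (forall z w, `|p z - p w| <= normc (z - w)) ->
  measurable_fun setT (fun t => p (circle_val t)).
Proof.
move=> plip; apply: (measurability _ (RGenOpens.measurableE R)).
move=> _ [_ [a [b ->] <-]]; rewrite setTI; apply: borel_open.
exists (p @^-1` `]a, b[%classic) => //.
rewrite openE => z /= zab; apply/nbhs_ballP.
have [e /= e0 eab] : exists2 e : R, 0 < e & ball (p z) e `<=` `]a, b[%classic.
  by apply/nbhs_ballP; apply: open_nbhs_nbhs; split=> //; exact: interval_open.
exists e%:C%C => /=; first by rewrite ltcR.
move=> w; rewrite -ball_normE /= normr_normc ltcR => zw.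
by apply: eab; rewrite -ball_normE /=; exact: le_lt_trans zw.
Qed.

Lemma bounded_measurable_circle_val :
  bounded_measurable (@circle_val R : borel_circle R -> CC R).
Proof.
split; last by exists 1 => t; rewrite normc_circle.
  by apply: measurable_circle_part => z w; rewrite -raddfB normr_Re_le.
by apply: measurable_circle_part => z w; rewrite -raddfB normr_Im_le.
Qed.

(** The cells are the traces on the circle of a square grid of step [1 / N]:
    the index of a point is the pair of integer parts of [N * (x + 1)] and
    [N * (y + 1)], which both lie between [0] and [2 * N]. *)
Lemma circle_partition (e : R) : 0 < e ->
  exists (I : finType) (idx : borel_circle R -> I),
    (forall i, measurable [set t | idx t = i]) /\
    forall s t, idx s = idx t -> normc (circle_val s - circle_val t) <= e.
Proof.
move=> e0; have [N [N0 Ne]] : exists N : nat, (0 < N)%N /\ 2 / N%:R <= e.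
  exists (Num.trunc (2 / e)).+1; split=> //.
  rewrite ler_pdivrMr// mulrC -ler_pdivrMr// ltW//.
  by have /andP[] := truncn_itv (divr_ge0 (ler0n R 2) (ltW e0)).
pose q (x : R) : 'I_(N.*2.+1) := inord (Num.trunc (N%:R * (x + 1))).
have qle (x : R) : `|x| <= 1 -> (Num.trunc (N%:R * (x + 1)) < N.*2.+1)%N.
  move=> x1; have /andP[x2 x3] : -1 <= x <= 1 by rewrite -ler_norml.
  rewrite truncn_lt_nat.
    rewrite -muln2 -natr1 natrM.
    have : N%:R * (x + 1) <= N%:R * 2 by rewrite ler_wpM2l//; lra.
    lra.
  by rewrite mulr_ge0//; lra.
have N0R : 0 < N%:R :> R by rewrite ltr0n.
have qP (x : R) i : `|x| <= 1 -> (q x == i) = (i%:R <= N%:R * (x + 1) < i.+1%:R).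
  move=> x1; rewrite -truncn_eq; last first.
    have /andP[x2 x3] : -1 <= x <= 1 by rewrite -ler_norml.
    by rewrite mulr_ge0//; lra.
  by rewrite -val_eqE /= inordK// qle.
have qdist (x y : R) : `|x| <= 1 -> `|y| <= 1 -> q x = q y -> `|x - y| <= 1 / N%:R.
  move=> x1 y1 /eqP; rewrite qP// => /andP[a1 a2].
  have /andP[b1 b2] : (q y)%:R <= N%:R * (y + 1) < (q y).+1%:R by rewrite -qP.
  rewrite ler_pdivlMr// -[N%:R]gtr0_norm// -normrM ler_norml.
  rewrite -natr1 in a2 b2; apply/andP; split; nra.
have Re1 t : `|complex.Re (circle_val t)| <= 1.
  by rewrite (le_trans (normr_Re_le _))// normc_circle.
have Im1 t : `|complex.Im (circle_val t)| <= 1.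
  by rewrite (le_trans (normr_Im_le _))// normc_circle.
have mq (p : borel_circle R -> R) i : measurable_fun setT p ->
    (forall t, `|p t| <= 1) -> measurable [set t | q (p t) = i].
  move=> mp p1.
  have -> : [set t | q (p t) = i] = setT `&`
      (fun t => N%:R * (p t + 1)) @^-1` `[i%:R, i.+1%:R[%classic.
    rewrite setTI; apply/seteqP; split=> t /=; rewrite in_itv /=.
      by move=> /eqP; rewrite qP.
    by rewrite -qP// => /eqP.
  have mf : measurable_fun setT (fun t => N%:R * (p t + 1)).
    by apply: measurable_funM => //; apply: measurable_funD.
  by apply: mf => //; exact: measurable_itv.
exists ('I_(N.*2.+1) * 'I_(N.*2.+1))%type.
exists (fun t => (q (complex.Re (circle_val t)), q (complex.Im (circle_val t)))).
have [mRe mIm _] := bounded_measurable_circle_val.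
split=> [[i j]|s t [qRe qIm]].
  have -> : [set t | (q (complex.Re (circle_val t)),
                      q (complex.Im (circle_val t))) = (i, j)] =
      [set t | q (complex.Re (circle_val t)) = i] `&`
      [set t | q (complex.Im (circle_val t)) = j].
    by apply/seteqP; split=> t /=; [case=> -> ->|case=> -> ->].
  by apply: measurableI; exact: mq.
apply: le_trans (normc_le_ReIm _) _; rewrite !raddfB /=.
have := qdist _ _ (Re1 s) (Re1 t) qRe; have := qdist _ _ (Im1 s) (Im1 t) qIm.
by move=> h1 h2; apply: le_trans (lerD h2 h1) _; rewrite -mulrDl; exact: Ne.
Qed.

Variable nu : probability (borel_circle R) R.

(** One null set contains every point around which the measure vanishes at
    scale [e]: the cell of such a point, having diameter at most [e], is null,
    and there are finitely many cells. *)
Lemma negligible_null_balls (e : R) : 0 < e -> exists2 F, nu.-negligible F &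
  forall t U, measurable U -> nu U = 0%E ->
    (forall s, normc (circle_val t - circle_val s) <= e -> U s) -> F t.
Proof.
move=> e0; have [I [idx [midx idx_e]]] := circle_partition e0.
exists (\big[setU/set0]_(i <- index_enum I | nu [set t | idx t = i] == 0%E)
         [set t | idx t = i]).
  elim/big_ind: _ => [|A B|i /eqP i0].
  - exact: negligible_set0.
  - exact: negligibleU.
  - by exists [set t | idx t = i]; split.
move=> t U mU U0 tU; rewrite -bigcup_seq_cond; exists (idx t) => //=.
rewrite mem_index_enum /= -measure_le0 -U0 le_measure ?inE//.
by move=> s /= st; apply: tU; exact: idx_e.
Qed.

(** A point outside the support has a null neighborhood, hence a null disc of
    radius [1 / n.+1] for some [n]; the countable union of the null sets
    attached to these scales covers the complement. *)
Lemma negligible_measure_supportC : nu.-negligible (~` measure_support nu).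
Proof.
have /choice[F FP] : forall n, exists F : set (borel_circle R), nu.-negligible F /\
    forall t U, measurable U -> nu U = 0%E ->
      (forall s, normc (circle_val t - circle_val s) <= n.+1%:R^-1 -> U s) -> F t.
  move=> n; have n0 : 0 < n.+1%:R^-1 :> R by rewrite invr_gt0 ltr0n.
  by have [F F0 FP] := negligible_null_balls n0; exists F.
apply: (negligibleS _ (negligible_bigcup (fun n => (FP n).1))).
move=> t /= /existsNP[U /not_implyP[oU /not_implyP[Ut /negP]]].
rewrite -leNgt measure_le0 => /eqP U0.
have [e e0 eU] := open_circleE oU Ut.
have [n ne] : exists n, n.+1%:R^-1 < e.
  exists (Num.trunc e^-1); rewrite invf_plt ?posrE ?ltr0n//.
  by have /andP[] := truncn_itv (ltW (eqbRL (invr_gt0 e) e0)).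
exists n => //; apply: (FP n).2 U0 _ => //; first exact: borel_open.
by move=> s ts; apply: eU; exact: le_lt_trans ne.
Qed.

Lemma fourier_coefN j : fourier_coef nu (- j%:Z) = cintegral nu (fun t => circle_val t ^+ j).
Proof. by rewrite /fourier_coef /= opprK. Qed.

(** The approximation of [y] has two steps, each costing [e / 2]: from [y] to
    [(r ^+ j * y j)_j], then from there to a Riemann sum, which is an element
    of [S0] by [S0_barycenter]. *)
Lemma fourier_coef_S0 (y : c0 R) :
  (forall j : nat, y j = fourier_coef nu (- j%:Z)) -> S0 y.
Proof.
move=> yE; apply: S0_approx => e e0.
have e20 : 0 < e / 2 by rewrite divr_gt0.
have [J yJ] := (cvgn_normcP _ _).1 (c0_cvg y) _ e20.
(* [eta] is chosen so that [r = 1 - eta] changes the coordinates below the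
   rank [J] by at most [J * M * eta <= e / 2]; those from [J] on are small
   themselves. *)
pose M := c0_normR y; have M0 : 0 <= M := c0_normR_ge0 y.
have K0 : 0 <= J%:R * M by rewrite mulr_ge0.
pose eta := e / 2 / (J%:R * M + e).
have eta0 : 0 < eta by rewrite divr_gt0// ltr_wpDl.
have eta1 : eta < 1 by rewrite ltr_pdivrMr ?ltr_wpDl//; lra.
have etaJ : J%:R * M * eta <= e / 2.
  by rewrite /eta mulrCA ler_piMr ?(ltW e20)// ler_pdivrMr ?ltr_wpDl// mul1r lerDl ltW.
pose r := 1 - eta; have r0 : 0 <= r by rewrite subr_ge0 ltW.
have r1 : r < 1 by rewrite /r ltrBlDr ltrDl.
have r01 : 0 <= r < 1 by rewrite r0 r1.
have dist_r j : normc (y j - r%:C%C ^+ j * y j) <= e / 2.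
  rewrite -{1}[y j]mul1r -mulrBl normcM -rmorphXn -(rmorph1 (real_complex R)).
  rewrite -rmorphB normc_real ger0_norm ?subr_ge0 ?exprn_ile1 ?(ltW r1)//.
  have [jJ|Jj] := ltnP j J; last first.
    have := yJ _ Jj; rewrite sub0r normcN => /ltW; apply: le_trans.
    by rewrite ler_piMl ?normc_ge0// gerBl exprn_ge0.
  apply: le_trans etaJ; rewrite mulrAC ler_pM ?subr_ge0 ?exprn_ile1 ?(ltW r1)//.
  - exact: normc_ge0.
  - apply: (@le_trans _ _ (j%:R * eta)); last by rewrite ler_wpM2r ?ltW// ltr_nat.
    (* Bernoulli's inequality [1 - (1 - eta) ^+ j <= j * eta]. *)
    elim: j {jJ} => [|j IH]; first by rewrite expr0 subrr mul0r.
    have rj : r ^+ j <= 1 by rewrite exprn_ile1// ltW.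
    have -> : 1 - r ^+ j.+1 = 1 - r ^+ j + r ^+ j * eta.
      by rewrite exprS /r; ring.
    by rewrite -natr1 mulrDl mul1r lerD// ler_piMl// ltW.
  - exact: normc_le_c0_normR.
have d0 : 0 < e / 4 * (1 - r) by rewrite mulr_gt0 ?divr_gt0// subr_gt0.
have [I [idx [midx idx_d]]] := circle_partition d0.
(* A sample point in each cell, and an arbitrary point for an empty cell,
   whose weight is zero. *)
pose s i : borel_circle R := xget point [set t | idx t = i].
have sP t : idx (s (idx t)) = idx t.
  by apply: (@xgetPex _ point [set u | idx u = idx t]); exists t.
pose w i := fine (nu [set t | idx t = i]).
have norm_r t : normc (r%:C%C * circle_val t) = r.
  by rewrite normcM normc_circle mulr1 normc_real ger0_norm.
have [||i|x xS xE] := @S0_barycenter _ I w (fun i => r%:C%C * circle_val (s i)).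
- by move=> i; exact: fine_ge0.
- apply: (@complexI R); rewrite rmorph_sum rmorph1 -(cintegral_cst nu 1).
  rewrite (cintegral_step nu midx (fun=> 1)).
  by apply: eq_bigr => i _; rewrite mulr1.
- by rewrite norm_r.
exists x => // j.
rewrite -(subrKA (r%:C%C ^+ j * y j)) [e]splitr.
apply: le_trans (le_normcD _ _) (lerD (dist_r j) _).
have bpow : bounded_measurable (fun t : borel_circle R => (r%:C%C * circle_val t) ^+ j).
  apply: bounded_measurableX; apply: bounded_measurableM.
    exact: bounded_measurable_cst.
  exact: bounded_measurable_circle_val.
have -> : r%:C%C ^+ j * y j =
    cintegral nu (fun t => (r%:C%C * circle_val t) ^+ j).
  rewrite yE fourier_coefN -cintegralZ; last first.
    by apply: bounded_measurableX; exact: bounded_measurable_circle_val.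
  by congr cintegral; apply/funext => t; rewrite exprMn.
pose v i := (r%:C%C * circle_val (s i)) ^+ j.
rewrite xE -(cintegral_step nu midx v) -cintegralB//; last first.
  exact: bounded_measurable_step.
have -> : e / 2 = (e / 4) *+ 2 by rewrite mulr2n; field.
apply: (@normc_cintegral_le _ _ _ _ setT) => //.
- by rewrite setCT measure0.
- apply: bounded_measurableB => //; exact: bounded_measurable_step.
- by rewrite divr_ge0// ltW.
move=> t _; apply: le_trans (normc_pow_dist _ r01 _ _) _; rewrite ?norm_r//.
rewrite ler_pdivrMr ?subr_gt0// -mulrBr normcM normc_real ger0_norm//.
have st : normc (circle_val t - circle_val (s (idx t))) <= e / 4 * (1 - r).
  by apply: idx_d; rewrite sP.
by apply: le_trans st; rewrite ler_piMl ?normc_ge0// ltW.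
Qed.

End CircleMeasure.

(** * Power series with absolutely summable coefficients *)

Section PowerSeries.
Context {R : realType}.
Variable b : nat -> CC R.
Hypothesis b1 : ell1 b.

Lemma power_series_tail (e : R) : 0 < e -> exists N, forall z n,
  normc z <= 1 -> (N <= n)%N ->
  normc (power_series b z - \sum_(k < n) b k * z ^+ k) <= e.
Proof.
move=> e0; have [N bN] := dominated_series b1 e0; exists N => z n z1 Nn.
have [k|_ /(_ n Nn)] := bN (fun k => b k * z ^+ k) 1 ler01.
  by rewrite mul1r normcM ler_piMr ?normc_ge0// normcX exprn_ile1 ?normc_ge0.
by rewrite mul1r /series /= big_mkord.
Qed.

(** Since [sup] is [0] on unbounded sets, a non-zero supremum is a genuine
    upper bound. *)
Lemma normc_le_disc_sup_norm (g : CC R -> CC R) z :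
  disc_sup_norm g != 0 -> normc z <= 1 -> normc (g z) <= disc_sup_norm g.
Proof.
move=> g0 z1; rewrite /disc_sup_norm; apply: ub_le_sup; last first.
  by exists z => //=; move: z1; rewrite -lecR; exact.
apply: contrapT => gub; move: g0; rewrite /disc_sup_norm sup_out ?eqxx//.
by case.
Qed.

(** The coupling of [y] with [b] is the integral of the power series: the
    partial sums are integrals of polynomials that are uniformly close to
    [beta] on [E], which has full measure. *)
Lemma coupling_fourier_coef (nu : probability (borel_circle R) R)
    (E : set (circle R)) (beta : CC R) (y : c0 R) :
  (forall j : nat, y j = fourier_coef nu (- j%:Z)) ->
  measurable (E : set (borel_circle R)) -> nu (~` E) = 0%E ->
  (forall t, E t -> power_series b (circle_val t) = beta) ->
  coupling b y = beta.
Proof.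
move=> yE mE nuE fE; apply: (cvg_lim (@norm_hausdorff _ _)).
apply/cvgn_normcP => e e0; have e40 : 0 < e / 4 by rewrite divr_gt0.
have [N bN] := power_series_tail e40; exists N => n Nn.
have powb k : bounded_measurable (fun t : borel_circle R => circle_val t ^+ k).
  exact/bounded_measurableX/bounded_measurable_circle_val.
have termb k : bounded_measurable (fun t : borel_circle R => b k * circle_val t ^+ k).
  by apply: bounded_measurableM => //; exact: bounded_measurable_cst.
have -> : [series y n * b n]_n n =
    cintegral nu (fun t => \sum_(k < n) b k * circle_val t ^+ k).
  rewrite cintegral_sum//.
  rewrite /series /= big_mkord; apply: eq_bigr => k _.
  by rewrite cintegralZ// -fourier_coefN -yE mulrC.
have sumb : bounded_measurable
    (fun t : borel_circle R => \sum_(k < n) b k * circle_val t ^+ k).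
  by apply: bounded_measurable_sum => k; exact: termb.
have cstb : bounded_measurable (fun _ : borel_circle R => beta).
  exact: bounded_measurable_cst.
rewrite -[X in normc (X - _)](cintegral_cst nu) -cintegralB//.
apply: (@le_lt_trans _ _ ((e / 4) *+ 2)); last by rewrite mulr2n; lra.
apply: (normc_cintegral_le mE nuE) => //; first exact: bounded_measurableB.
  exact: ltW.
by move=> t Et; rewrite -(fE t Et) bN// normc_circle.
Qed.

End PowerSeries.

(** * The modulus support point given by a Rajchman measure *)

Theorem theorem3p3 (R : realType) (E : set (circle R)) (b : nat -> CC R)
    (nu : probability (borel_circle R) R) :
  weak_peak_set E ->
  ell1 b -> weak_peak_function E (power_series b) ->
  rajchman nu -> measure_support nu `<=` E ->
  modulus_support_functional (coupling b) (@S0 R) /\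
  exists y : c0 R, (forall j : nat, y j = fourier_coef nu (- j%:Z)) /\
    modulus_support_point (coupling b) S0 y.
Proof.
move=> [cE _ _] b1 [_ [beta [beta0 fE f_sup]]] nuR supE.
have nuE : nu (~` E) = 0%E.
  apply: measure_negligible.
    by apply: measurableC; exact: borel_closed.
  apply: negligibleS (negligible_measure_supportC nu).
  exact: subsetC.
have [y yE] : exists y : c0 R, forall j : nat, y j = fourier_coef nu (- j%:Z).
  have y0 : (fun j : nat => fourier_coef nu (- j%:Z)) \in @c0_pred R.
    exact/asboolP.
  by exists (MkC0 y0).
have yS : S0 y := fourier_coef_S0 yE.
have hy : coupling b y = beta.
  exact: (coupling_fourier_coef b1 yE (borel_closed cE) nuE fE).
have S0_le x : S0 x -> normc (coupling b x) <= normc beta.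
  move=> xS; rewrite -lecR.
  apply: (S0_sub_le (B := `|beta|) (coupling_linear b1)
    (coupling_continuous b1)) x xS => x l l1 xl.
  rewrite !normr_normc lecR -f_sup; have -> : coupling b x = power_series b l.
    by congr (limn (series _)); apply/funext => n; rewrite -[LHS]/(x n * b n) xl mulrC.
  apply: normc_le_disc_sup_norm; last exact: ltW.
  by rewrite f_sup; apply: contra_neq beta0; exact: eq0_normc.
have y_max : attains_modulus_sup (coupling b) S0 y.
  split=> //; rewrite hy; apply/le_anti/andP; split.
    apply: ub_le_sup; last by exists y => //; rewrite hy.
    by exists (normc beta) => _ [x xS <-]; exact: S0_le.
  apply: ge_sup; first by exists (normc beta), y => //; rewrite hy.
  by move=> _ [x xS <-]; exact: S0_le.
have hS : modulus_support_functional (coupling b) (@S0 R).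
  split.
  - split; [exact: S0_neq0|exact: S0_bounded| |].
    + exact: closed_convex_hull_closed.
    + exact: closed_convex_hull_convex.
  - exact: coupling_linear.
  - exact: coupling_continuous.
  - by exists y; rewrite hy.
  - by exists y.
by split=> //; exists y.
Qed.
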